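(* Let $R$ be a ring with unity $1\neq 0$ which is not a field, and let $M$ be a left $R$-module such that $M$ is either Artinian, or locally finite, or of finite length. Then $M$ is an $\mathrm{SM}$ module.
   Context: A left $R$-module $M$ is an $\mathrm{SM}$ module if every nontrivial (i.e. nonzero) submodule of $M$ contains a simple submodule. A module is locally finite if each of its finitely generated submodules is a finite set. *)

(* Defs.v *)
From HB Require Import structures.
From mathcomp Require Import all_boot all_order all_algebra.
From mathcomp Require Import boolp classical_sets functions cardinality.

Set Implicit Arguments.
Unset Strict Implicit.
Unset Printing Implicit Defensive.

Import GRing.Theory.
Local Open Scope classical_set_scope.
Local Open Scope ring_scope.

(* A field is in particular commutative; [nzRingType] already gives 1 != 0. *)
Definition ring_is_field (R : nzRingType) : Prop :=
  commutative (@GRing.mul R) /\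
  forall x : R, x != 0 -> exists y : R, x * y = 1.

Section Modules.
Context {R : nzRingType} {M : lmodType R}.

(* [mem] turns the Prop-valued set N into the collective predicate expected by
   [submod_closed]; membership is decided classically. *)
Definition submodule (N : set M) : Prop := submod_closed (mem N).

Lemma submoduleE (N : set M) :
  submodule N <-> N 0 /\ forall (a : R) u v, N u -> N v -> N (a *: u + v).
Proof.
split=> -[N0 NL]; split.
- by move: N0; rewrite inE.
- by move=> a u v Nu Nv; have := NL a u v; rewrite !inE; apply.
- by rewrite inE.
- by move=> a u v; rewrite !inE; apply: NL.
Qed.

Definition simple_submodule (S : set M) : Prop :=
  [/\ submodule S, S <> [set 0] &
      forall N : set M, submodule N -> N `<=` S -> N = [set 0] \/ N = S].

Definition submodule_span (X : set M) : set M := smallest submodule X.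

Definition finitely_generated (N : set M) : Prop :=
  exists2 X : set M, finite_set X & N = submodule_span X.

Definition maximal_submodule_of (A B : set M) : Prop :=
  [/\ submodule A, submodule B, A `<` B &
      forall N : set M, submodule N -> A `<=` N -> N `<=` B -> N = A \/ N = B].

(* 0 = F 0 < F 1 < ... < F n = M, each term maximal in the next, i.e. with
   simple factors; the values of F beyond n are irrelevant. *)
Definition composition_series (n : nat) (F : nat -> set M) : Prop :=
  [/\ F 0%N = [set 0], F n = [set: M] &
      forall i, (i < n)%N -> maximal_submodule_of (F i) (F i.+1)].

End Modules.

Section ModuleProperties.
Context {R : nzRingType} (M : lmodType R).

Definition artinian_module : Prop :=
  forall F : nat -> set M,
    (forall n, submodule (F n)) -> (forall n, F n.+1 `<=` F n) ->
    exists n, forall m, (n <= m)%N -> F m = F n.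

Definition locally_finite_module : Prop :=
  forall N : set M, submodule N -> finitely_generated N -> finite_set N.

Definition finite_length_module : Prop :=
  exists (n : nat) (F : nat -> set M), composition_series n F.

Definition SM_module : Prop :=
  forall N : set M, submodule N -> N <> [set 0] ->
    exists2 S : set M, simple_submodule S & S `<=` N.

End ModuleProperties.

(* Main.v *)
Require Import Defs.
From mathcomp Require Import all_boot all_order all_algebra.
From mathcomp Require Import boolp classical_sets functions cardinality.
From mathcomp Require Import finmap.

(**
  A nonzero submodule satisfying the descending chain condition contains a
  simple one: otherwise dependent choice yields an infinite strictly
  descending chain.  This covers Artinian modules, and locally finite ones
  after passing to the (finite) cyclic submodule generated by a nonzero
  element.  Given a composition series [F] and a nonzero [N], take the least
  [i] with [N] meeting [F i.+1] nontrivially.  Then [N `&` F i] is zero, and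
  the intersection of [N] with [F i.+1] is simple because it embeds in
  [F i.+1 / F i].
*)

Import GRing.Theory.
Local Open Scope classical_set_scope.
Local Open Scope ring_scope.

Section Submodules.
Context {R : nzRingType} {M : lmodType R}.
Implicit Types A B N X : set M.

Lemma submodule0 A : submodule A -> A 0.
Proof. by case/submoduleE. Qed.

Lemma submoduleD A u v : submodule A -> A u -> A v -> A (u + v).
Proof. by case/submoduleE=> _ + Au Av; move=> /(_ 1 u v Au Av); rewrite scale1r. Qed.

Lemma submoduleB A u v : submodule A -> A u -> A v -> A (u - v).
Proof.
by case/submoduleE=> _ + Au Av; move=> /(_ (-1) v u Av Au); rewrite scaleN1r addrC.
Qed.

Lemma submoduleI A B : submodule A -> submodule B -> submodule (A `&` B).
Proof.
move=> /submoduleE[A0 AL] /submoduleE[B0 BL]; apply/submoduleE; split=> //.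
by move=> a u v [Au Bu] [Av Bv]; split; [apply: AL | apply: BL].
Qed.

Definition submodule_add A B : set M :=
  [set x | exists2 a, A a & exists2 b, B b & x = a + b].

Lemma submodule_addP A B :
  submodule A -> submodule B -> submodule (submodule_add A B).
Proof.
move=> /submoduleE[A0 AL] /submoduleE[B0 BL]; apply/submoduleE; split.
  by exists 0 => //; exists 0; rewrite ?addr0.
move=> c _ _ [a Aa [b Bb ->]] [a' Aa' [b' Bb' ->]].
exists (c *: a + a'); first exact: AL.
by exists (c *: b + b'); [exact: BL | rewrite scalerDr addrACA].
Qed.

Lemma submodule_span_submodule X : submodule (submodule_span X).
Proof.
apply/submoduleE; split; first by move=> A [/submodule0].
move=> a u v Xu Xv A [sA XA]; have [_ AL] := (submoduleE A).1 sA.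
by apply: AL; [apply: Xu | apply: Xv].
Qed.

Lemma submodule_neq0 A : submodule A -> A <> [set 0] ->
  exists2 x, A x & x <> 0.
Proof.
move=> sA nA; apply: contrapT => noA; apply: nA; apply/seteqP; split=> x /=.
  by move=> Ax; apply: contrapT => x0; apply: noA; exists x.
by move=> ->; apply: submodule0.
Qed.

(** The chain condition asks for a single repetition, and only in chains starting at [N], so that it
    follows both from the Artinian property of [M] and from finiteness of [N]. *)
Lemma simple_submodule_of_dcc N : submodule N -> N <> [set 0] ->
  (forall F : nat -> set M, F 0%N = N -> (forall n, submodule (F n)) ->
     (forall n, F n.+1 `<=` F n) -> exists n, F n.+1 = F n) ->
  exists2 S, simple_submodule S & S `<=` N.
Proof.
move=> sN nN dcc; apply: contrapT => noS.
pose P A := [/\ submodule A, A <> [set 0] & A `<=` N].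
(* Keeping [P A] under the existential lets [choice] return a total function; outside [P] the value
   [A] is a dummy. *)
have step A : exists B, P A -> [/\ P B, B `<=` A & B <> A].
  have [PA|?] := pselect (P A); last by exists A.
  apply: contrapT => noB; case: (PA) => sA nA AN; apply: noS.
  exists A => //; split=> // B sB BA.
  have [B0|nB] := pselect (B = [set 0]); first by left.
  right; apply: contrapT => nBA; apply: noB; exists B => _.
  by split=> //; split=> //; apply: subset_trans AN.
have [g gP] := choice step.
have PF n : P (iter n g N) by elim: n => [|n /gP[]]; first split.
have [|||n] := dcc (fun n => iter n g N) => //.
- by move=> n; case: (PF n).
- by move=> n; case: (gP _ (PF n)).
- by case: (gP _ (PF n)).
Qed.

(** If no two consecutive terms agreed, cardinalities would drop by at least one at each step, which
    a finite starting set cannot sustain. *)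
Lemma finite_set_descending (T : choiceType) (F : nat -> set T) :
  finite_set (F 0%N) -> (forall n, F n.+1 `<=` F n) ->
  exists n, F n.+1 = F n.
Proof.
move=> fin0 decr; apply: contrapT => strict.
have fin n : finite_set (F n) by elim: n => // n; apply: sub_finite_set.
have lt_card n : (#|` fset_set (F n.+1)| < #|` fset_set (F n)|)%N.
  apply: fproper_ltn_card; rewrite fproperEneq; apply/andP; split.
    by apply/eqP => eqF; apply: strict; exists n; apply: fset_set_inj eqF.
  by rewrite -fset_set_sub.
have card_bound n : (n + #|` fset_set (F n)| <= #|` fset_set (F 0%N)|)%N.
  elim: n => // n; apply: leq_trans.
  by rewrite addSnnS leq_add2l.
(* One step more than the size of [F 0] already violates the bound. *)
have := leq_trans (leq_addr _ _) (card_bound #|` fset_set (F 0%N)|.+1).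
by rewrite ltnn.
Qed.

(** The embedding into [B / A] is handled without quotients: a submodule [K] of the intersection
    gives [K + A] between [A] and [B], so maximality forces one of the two ends. *)
Lemma simple_submoduleI_maximal N A B :
  submodule N -> maximal_submodule_of A B ->
  N `&` A = [set 0] -> N `&` B <> [set 0] -> simple_submodule (N `&` B).
Proof.
move=> sN [sA sB [AB _] maxA] NA0 NB0; split=> //; first exact: submoduleI.
move=> K sK KNB; have [K0|nK] := pselect (K = [set 0]); [by left | right].
have KN : K `<=` N by move=> x /KNB[].
have KB : K `<=` B by move=> x /KNB[].
have [] := maxA _ (submodule_addP _ _ sK sA).
- by move=> x Ax; exists 0; [exact: submodule0 | exists x; rewrite ?add0r].
- by move=> _ [k Kk [a Aa ->]]; apply: submoduleD; [|exact: KB|exact: AB].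
(* If [K + A = A], then [K] lies in both [N] and [A], hence is zero. *)
- move=> KA; have [x Kx] := submodule_neq0 _ sK nK; case.
  suff : (N `&` A) x by rewrite NA0.
  split; first exact: KN.
  by rewrite -KA; exists x => //; exists 0; [exact: submodule0|rewrite addr0].
(* If [K + A = B], the modular law applies: in [x = k + a] the term [a = x - k] lies in [N] and [A],
   so it vanishes and [x = k]. *)
- move=> KAB; apply/seteqP; split=> // x [Nx].
  rewrite -KAB => -[k Kk [a Aa xE]].
  suff a0 : a = 0 by rewrite xE a0 addr0.
  suff : (N `&` A) a by rewrite NA0.
  split=> //; have -> : a = x - k by rewrite xE addrC addKr.
  by apply: submoduleB => //; exact: KN.
Qed.

End Submodules.

Section SimpleSubmodules.
Context {R : nzRingType} (M : lmodType R).

Lemma artinian_SM : artinian_module M -> SM_module M.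
Proof.
move=> art N sN nN; apply: simple_submodule_of_dcc => // F _ sF decr.
by have [n stat] := art F sF decr; exists n; apply: stat.
Qed.

Lemma locally_finite_SM : locally_finite_module M -> SM_module M.
Proof.
move=> lf N sN nN; have [x Nx x0] := submodule_neq0 _ sN nN.
pose C := submodule_span [set x].
have sC : submodule C := submodule_span_submodule _.
have CN : C `<=` N by apply: smallest_sub => // _ ->.
have Cx : C x by move=> A [_]; apply.
have nC : C <> [set 0] by move=> C0; apply: x0; move: Cx; rewrite C0.
have finC : finite_set C by apply: lf => //; exists [set x].
have [F F0 _ decr|S simpS SC] := simple_submodule_of_dcc _ sC nC.
  by apply: finite_set_descending; rewrite ?F0.
by exists S => //; apply: subset_trans CN.
Qed.

Lemma finite_length_SM : finite_length_module M -> SM_module M.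
Proof.
move=> [n [F [F0 Fn maxF]]] N sN nN.
pose P i := `[< N `&` F i <> [set 0] >].
have exP : exists i, P i by exists n; apply/asboolP; rewrite Fn setIT.
(* The least index is not 0, since [F 0] is zero; being a successor [i.+1], it leaves [N] meeting
   [F i] trivially. *)
case: (ex_minnP exP) => -[|i] /asboolP Pi minP.
  by case: Pi; rewrite F0 setIidr // => _ ->; apply: submodule0.
have lt_in : (i < n)%N by apply: minP; apply/asboolP; rewrite Fn setIT.
exists (N `&` F i.+1) => //; apply: (simple_submoduleI_maximal _ (F i)) => //.
- exact: maxF.
- apply: contrapT => nNFi.
  by have := minP i (asboolT nNFi); rewrite ltnn.
Qed.

End SimpleSubmodules.

Theorem proposition3p2 (R : nzRingType) (M : lmodType R)
    (hR : ~ ring_is_field R)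
    (hM : artinian_module M \/ locally_finite_module M \/
          finite_length_module M) :
  SM_module M.
Proof.
case: hM => [|[]].
- exact: artinian_SM.
- exact: locally_finite_SM.
- exact: finite_length_SM.
Qed.
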